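(* There is an arithmetical functional $F$ of type $(1\times1)\to0$ (i.e. $F:\mathbb N^{\mathbb N}\times\mathbb N^{\mathbb N}\to\mathbb N$) such that for every Pincherle realiser $M$, the function $G$ defined by $G(f)=M(\lambda g.F(f,g))$ is not Borel measurable.
   Context: $C=2^{\mathbb N}$ is Cantor space. For $f\in C$ and $n\in\mathbb N$, $\overline{f}n=\langle f(0),\dots,f(n-1)\rangle$, and $[\sigma]$ is the set of $g\in C$ extending the finite binary sequence $\sigma$. For $F,G:C\to\mathbb N$, $\mathsf{LOC}(F,G)$ means $(\forall f,g\in C)\big(g\in[\overline{f}G(f)]\to F(g)\le G(f)\big)$. A Pincherle realiser (PR) is a functional $M$ assigning natural numbers to functionals $G:C\to\mathbb N$ such that $(\forall F,G:C\to\mathbb N)\big(\mathsf{LOC}(F,G)\to(\forall g\in C)(F(g)\le M(G))\big)$. ''Arithmetical'' means definable by a formula of first-order arithmetic (with function arguments as parameters). A functional is Borel measurable if its graph is a Borel set (equivalently, preimages of open sets are Borel). *)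

(* Defs.v *)
From Stdlib Require Import Arith.

Definition baire := nat -> nat.
Definition cantor := nat -> bool.

Definition c2b (g : cantor) : baire := fun n => if g n then 1 else 0.

Definition ext_init {A : Type} (f g : nat -> A) (n : nat) : Prop :=
  forall i, i < n -> g i = f i.

Definition LOC (F G : cantor -> nat) : Prop :=
  forall f g : cantor, ext_init f g (G f) -> F g <= G f.

Definition PR (M : (cantor -> nat) -> nat) : Prop :=
  forall F G : cantor -> nat, LOC F G -> forall g : cantor, F g <= M G.

Inductive term : Type :=
| tvar  : nat -> term              (* number variable (de Bruijn index) *)
| tzero : term
| tsucc : term -> term
| tplus : term -> term -> term
| tmult : term -> term -> term
| tapp  : nat -> term -> term.     (* application of function parameter i *)

Inductive formula : Type :=
| feq  : term -> term -> formula
| flt  : term -> term -> formula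
| fnot : formula -> formula
| fand : formula -> formula -> formula
| for_ : formula -> formula -> formula
| fimp : formula -> formula -> formula
| fall : formula -> formula
| fex  : formula -> formula.

Definition scons (a : nat) (e : nat -> nat) : nat -> nat :=
  fun n => match n with 0 => a | S k => e k end.

Fixpoint eval (fe : nat -> nat -> nat) (e : nat -> nat) (t : term) : nat :=
  match t with
  | tvar n => e n
  | tzero => 0
  | tsucc u => S (eval fe e u)
  | tplus u v => eval fe e u + eval fe e v
  | tmult u v => eval fe e u * eval fe e v
  | tapp i u => fe i (eval fe e u)
  end.

Fixpoint sat (fe : nat -> nat -> nat) (e : nat -> nat) (p : formula) : Prop :=
  match p with
  | feq u v => eval fe e u = eval fe e v
  | flt u v => eval fe e u < eval fe e v
  | fnot q => ~ sat fe e q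
  | fand q r => sat fe e q /\ sat fe e r
  | for_ q r => sat fe e q \/ sat fe e r
  | fimp q r => sat fe e q -> sat fe e r
  | fall q => forall a, sat fe (scons a e) q
  | fex q => exists a, sat fe (scons a e) q
  end.

Definition fenv2 (f g : baire) : nat -> nat -> nat :=
  fun i => match i with 0 => f | 1 => g | _ => fun _ => 0 end.

(* F : N^N x N^N -> N is arithmetical: its graph is defined by a formula of
   first-order arithmetic with f, g as function parameters and the value n
   as free number variable 0. *)
Definition arithmetical2 (F : baire -> baire -> nat) : Prop :=
  exists phi : formula, forall (f g : baire) (n : nat),
    F f g = n <-> sat (fenv2 f g) (scons n (fun _ => 0)) phi.

Definition open_baire (U : baire -> Prop) : Prop :=
  forall x, U x -> exists n, forall y, ext_init x y n -> U y.

Inductive borel : (baire -> Prop) -> Prop :=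
| borel_open  : forall U, open_baire U -> borel U
| borel_compl : forall U, borel U -> borel (fun x => ~ U x)
| borel_union : forall A : nat -> baire -> Prop,
    (forall n, borel (A n)) -> borel (fun x => exists n, A n x)
| borel_ext   : forall U V, borel U -> (forall x, U x <-> V x) -> borel V.

Definition borel_measurable (G : baire -> nat) : Prop :=
  forall A : nat -> Prop, borel (fun x => A (G x)).

(* Main.v *)
Require Import Defs.
From Stdlib Require Import Arith Lia Classical ClassicalEpsilon.
From Stdlib Require Import Wellfounded Relation_Operators.

(** Let [x] code a well-founded tree presenting a Borel subset of Baire space,
    and let [g] be a candidate assignment of truth values, at the point [x]
    itself, to the nodes of that tree.  Correctness of [g] at one node relative
    to its children is arithmetical.  If [g] is not the true evaluation, take a
    node [s] where it fails, all nodes below [s] being fine: there [g] has the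
    wrong bit, so the ball of radius [s + 1] around [g] misses the true
    evaluation.  Let [F x g] be [s + 1] in that case; if [g] is fine
    everywhere, let [F x g] be [m + 1], where [m] is the index of the subtree of
    the root to which [g] gives value true.  Then the true evaluation lies only
    in its own ball, so every Pincherle realiser exceeds [m] on [F x].  Were
    [B x = M (F x)] Borel, the tree whose [n]-th subtree presents
    [{y | B y = n}] would yield [m = B x], hence [B x > B x]. *)

(** * Pairing *)

(** A polynomial, hence a term of the formal language. Since [a <= 2 * (a + b)], the square root
    recovers [a + b]. The pairing is not onto. *)
Definition pair (a b : nat) : nat := (a + b) * (a + b) + a.

Definition unpair (n : nat) : nat * nat :=
  let a := n - Nat.sqrt n * Nat.sqrt n in (a, Nat.sqrt n - a).

Lemma unpair_pair (a b : nat) : unpair (pair a b) = (a, b).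
Proof.
  unfold unpair, pair.
  rewrite (Nat.sqrt_unique _ (a + b)) by nia.
  f_equal; nia.
Qed.

Lemma unpair_snd_le (n : nat) : snd (unpair n) <= n.
Proof.
  unfold unpair; simpl.
  pose proof (Nat.sqrt_le_lin n); lia.
Qed.

(** * Borel codes *)

(** A [node] denotes the union of the complements of its subtrees, so one constructor serves for
    complements and countable unions. *)
Inductive bcode : Type :=
| leaf : nat -> nat -> bcode
| node : (nat -> bcode) -> bcode.

Fixpoint val (x : baire) (c : bcode) : Prop :=
  match c with
  | leaf a b => x a = b
  | node k => exists i, ~ val x (k i)
  end.

Definition coded (B : baire -> Prop) : Prop :=
  exists c, forall x, val x c <-> B x.

(** * Every Borel set has a code *)

Lemma coded_ext (A B : baire -> Prop) :
  (forall x, A x <-> B x) -> coded A -> coded B.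
Proof.
  intros E [c Hc]; exists c; intro x.
  rewrite Hc; apply E.
Qed.

Lemma coded_compl (A : baire -> Prop) : coded A -> coded (fun x => ~ A x).
Proof.
  intros [c Hc]; exists (node (fun _ => c)); intro x; simpl.
  rewrite <- Hc; split; [intros [_ H]; exact H | intro H; exists 0; exact H].
Qed.

Lemma coded_union (A : nat -> baire -> Prop) :
  (forall n, coded (A n)) -> coded (fun x => exists n, A n x).
Proof.
  intro H.
  (* Codes of the complements are chosen, because [node] complements each subtree once more. *)
  pose (c n := proj1_sig (constructive_indefinite_description _ (coded_compl _ (H n)))).
  exists (node c); intro x; simpl.
  assert (E : forall n, ~ val x (c n) <-> A n x).
  { intro n; unfold c.
    destruct (constructive_indefinite_description _ (coded_compl _ (H n))) as [d Hd]; simpl.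
    rewrite Hd; split; [apply NNPP | tauto]. }
  split; intros [n Hn]; exists n; apply E; exact Hn.
Qed.

Lemma coded_inter (A B : baire -> Prop) :
  coded A -> coded B -> coded (fun x => A x /\ B x).
Proof.
  intros HA HB.
  apply (coded_ext (fun x => ~ exists n, ~ match n with 0 => A x | S _ => B x end)).
  - intro x; split.
    + intro H; split; apply NNPP; intro N; apply H; [exists 0 | exists 1]; exact N.
    + intros [Ha Hb] [[|n] Hn]; tauto.
  - apply coded_compl, (coded_union (fun n x => ~ match n with 0 => A x | S _ => B x end)).
    intros [|n]; apply coded_compl; assumption.
Qed.

Lemma coded_const (P : Prop) : coded (fun _ => P).
Proof.
  assert (HF : coded (fun _ => False)).
  { apply (coded_ext (fun x => x 0 = 0 /\ x 0 = 1)).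
    - intro x; split; [intros [H1 H2]; congruence | tauto].
    - apply coded_inter; [exists (leaf 0 0) | exists (leaf 0 1)]; intro x; reflexivity. }
  destruct (classic P) as [H | H].
  - apply (coded_ext (fun _ => ~ False)); [tauto | apply coded_compl, HF].
  - apply (coded_ext (fun _ => False)); [tauto | exact HF].
Qed.

(** Split on the value [b] of coordinate [n]: once that coordinate is overwritten by [b], membership
    depends on the first [n] coordinates only. *)
Lemma coded_finitely_determined (n : nat) (A : baire -> Prop) :
  (forall x y, ext_init x y n -> A x -> A y) -> coded A.
Proof.
  revert A; induction n as [|n IH]; intros A HA.
  - apply (coded_ext (fun _ => A (fun _ => 0))); [|apply coded_const].
    intro x; split; apply HA; intros i Hi; lia.
  - pose (upd b (x : baire) i := if i =? n then b else x i).
    assert (Hupd : forall x, ext_init x (upd (x n) x) (S n)).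
    { intros x i _; unfold upd.
      destruct (Nat.eqb_spec i n); congruence. }
    apply (coded_ext (fun x => exists b, x n = b /\ A (upd b x))).
    + intro x; split.
      * intros [b [<- H]]; refine (HA _ _ _ H).
        intros i Hi; symmetry; apply Hupd, Hi.
      * intro H; exists (x n); split; [reflexivity | exact (HA _ _ (Hupd x) H)].
    + apply (coded_union (fun b x => x n = b /\ A (upd b x))); intro b.
      apply coded_inter; [exists (leaf n b); intro; reflexivity|].
      apply IH; intros x y E; apply HA; intros i Hi; unfold upd.
      destruct (Nat.eqb_spec i n); [reflexivity | apply E; lia].
Qed.

Lemma coded_open (U : baire -> Prop) : open_baire U -> coded U.
Proof.
  intro HU.
  apply (coded_ext (fun x => exists n, forall y, ext_init x y n -> U y)).
  - intro x; split; [|apply HU].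
    intros [n H]; apply H; intros i _; reflexivity.
  - apply (coded_union (fun n x => forall y, ext_init x y n -> U y)); intro n.
    apply (coded_finitely_determined n); intros x y E H z Ez.
    apply H; intros i Hi; rewrite Ez, E by assumption; reflexivity.
Qed.

Lemma borel_coded (B : baire -> Prop) : borel B -> coded B.
Proof.
  induction 1 as [U HU | U _ IH | A _ IH | U V _ IH E].
  - apply coded_open, HU.
  - apply coded_compl, IH.
  - apply coded_union, IH.
  - apply (coded_ext U); assumption.
Qed.

(** * The nodes of a code *)

Definition child (s i : nat) : nat := S (pair i s).

Definition sub_child (c : bcode) (i : nat) : bcode :=
  match c with leaf _ _ => c | node k => k i end.

(** Follows the path from the root [0] to [s]. The parent of [S p] is at most [p], so fuel [s]
    suffices. Numbers outside the range of [child] are decoded too, so every number names a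
    subtree. *)
Fixpoint sub_fuel (n : nat) (c : bcode) (s : nat) : bcode :=
  match n, s with
  | S n, S p => sub_child (sub_fuel n c (snd (unpair p))) (fst (unpair p))
  | _, _ => c
  end.

Lemma sub_fuel_irrel (c : bcode) (n m s : nat) :
  s <= n -> s <= m -> sub_fuel n c s = sub_fuel m c s.
Proof.
  revert m s; induction n as [|n IH]; intros [|m] [|p] Hn Hm; try reflexivity; try lia.
  cbn [sub_fuel]; pose proof (unpair_snd_le p).
  rewrite (IH m) by lia; reflexivity.
Qed.

Definition sub (c : bcode) (s : nat) : bcode := sub_fuel s c s.

Lemma sub_childE (c : bcode) (s i : nat) :
  sub c (child s i) = sub_child (sub c s) i.
Proof.
  unfold sub, child; cbn [sub_fuel].
  rewrite unpair_pair; cbn [fst snd]; f_equal.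
  apply sub_fuel_irrel; unfold pair; nia.
Qed.

Definition child_rel (c : bcode) (t s : nat) : Prop :=
  exists k i, sub c s = node k /\ t = child s i.

(** Transitive, because validity at the children alone does not make an assignment true there,
    whereas validity everywhere beneath does. *)
Definition below (c : bcode) : nat -> nat -> Prop := clos_trans nat (child_rel c).

Lemma below_wf (c : bcode) : well_founded (below c).
Proof.
  apply wf_clos_trans.
  assert (H : forall b s, sub c s = b -> Acc (child_rel c) s).
  { induction b as [a b | k IH]; intros s E; constructor;
      intros t [k' [i [E' ->]]].
    - congruence.
    - apply (IH i); rewrite sub_childE, E; reflexivity. }
  intro s; exact (H _ s eq_refl).
Qed.

(** * The arithmetical functional *)

(* The row [pair 0 _] of [f] tabulates the relation [below]; rows 1, 2 and 3
   say whether a node is a leaf and give the two arguments of [leaf]. *)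
Definition valid (f g : baire) (s : nat) : Prop :=
  g s = 1 <->
  (f (pair 1 s) = 1 /\ f (f (pair 2 s)) = f (pair 3 s)) \/
  (f (pair 1 s) = 0 /\ exists i, g (child s i) = 0).

Definition candidate (f g : baire) (m : nat) : Prop :=
  ((forall s, valid f g s) /\ g (child 0 m) = 1) \/
  (~ valid f g m /\ forall t, f (pair 0 (pair t m)) = 1 -> valid f g t).

(** Leastness makes the value unique. The shift to [S m] makes the ball of that radius fix position
    [m]; [0] is the default when there is no candidate. *)
Definition least_candidate (f g : baire) (n : nat) : Prop :=
  (exists m, n = S m /\ candidate f g m /\ forall j, j < m -> ~ candidate f g j) \/
  (n = 0 /\ forall j, ~ candidate f g j).

Lemma least_candidate_exists (f g : baire) : exists n, least_candidate f g n.
Proof.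
  destruct (classic (exists m, candidate f g m)) as [[m Hm] | H].
  - assert (L : exists m, candidate f g m /\ forall j, j < m -> ~ candidate f g j).
    { induction m as [m IH] using lt_wf_ind.
      destruct (classic (exists j, j < m /\ candidate f g j)) as [[j [Hj Cj]] | N].
      - exact (IH j Hj Cj).
      - exists m; split; [exact Hm|].
        intros j Hj Cj; apply N; exists j; tauto. }
    destruct L as [l Hl]; exists (S l); left; exists l; tauto.
  - exists 0; right; split; [reflexivity|].
    intros j Hj; apply H; exists j; exact Hj.
Qed.

Lemma least_candidate_unique (f g : baire) (n n' : nat) :
  least_candidate f g n -> least_candidate f g n' -> n = n'.
Proof.
  intros [[m [-> [Cm Lm]]] | [-> N]] [[m' [-> [Cm' Lm']]] | [-> N']].
  - destruct (lt_eq_lt_dec m m') as [[H | ->] | H]; [|reflexivity|].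
    + destruct (Lm' m H Cm).
    + destruct (Lm m' H Cm').
  - destruct (N' m Cm).
  - destruct (N m' Cm').
  - reflexivity.
Qed.

Definition first_candidate (f g : baire) : nat :=
  proj1_sig (constructive_indefinite_description _ (least_candidate_exists f g)).

Lemma first_candidateP (f g : baire) : least_candidate f g (first_candidate f g).
Proof.
  exact (proj2_sig (constructive_indefinite_description _ (least_candidate_exists f g))).
Qed.

(** * The formula defining the functional *)

Definition tone : term := tsucc tzero.

Definition tpair (u v : term) : term := tplus (tmult (tplus u v) (tplus u v)) u.

Definition tchild (u v : term) : term := tsucc (tpair v u).

Definition fvalid (s : nat) : formula :=
  let row k := tapp 0 (tpair k (tvar s)) in
  let rhs :=
    for_ (fand (feq (row tone) tone)
               (feq (tapp 0 (row (tsucc tone))) (row (tsucc (tsucc tone)))))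
         (fand (feq (row tone) tzero)
               (fex (feq (tapp 1 (tchild (tvar (S s)) (tvar 0))) tzero))) in
  let lhs := feq (tapp 1 (tvar s)) tone in
  fand (fimp lhs rhs) (fimp rhs lhs).

Definition fcandidate (m : nat) : formula :=
  for_ (fand (fall (fvalid 0)) (feq (tapp 1 (tchild tzero (tvar m))) tone))
       (fand (fnot (fvalid m))
             (fall (fimp (feq (tapp 0 (tpair tzero (tpair (tvar 0) (tvar (S m))))) tone)
                         (fvalid 0)))).

Definition fleast : formula :=
  for_ (fex (fand (feq (tvar 1) (tsucc (tvar 0)))
                  (fand (fcandidate 0)
                        (fall (fimp (flt (tvar 0) (tvar 1)) (fnot (fcandidate 0)))))))
       (fand (feq (tvar 0) tzero) (fall (fnot (fcandidate 0)))).

(** The formulas copy the definitions connective by connective, so both sides are convertible. *)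
Lemma sat_fleast (f g : baire) (n : nat) :
  sat (fenv2 f g) (scons n (fun _ => 0)) fleast <-> least_candidate f g n.
Proof. apply iff_refl. Qed.

Lemma first_candidate_arithmetical : arithmetical2 first_candidate.
Proof.
  exists fleast; intros f g n; rewrite sat_fleast; split.
  - intros <-; apply first_candidateP.
  - apply least_candidate_unique, first_candidateP.
Qed.

(** * The point coding a Borel code *)

Definition indicator (P : Prop) : nat := if excluded_middle_informative P then 1 else 0.

Lemma indicator_eq1 (P : Prop) : indicator P = 1 <-> P.
Proof.
  unfold indicator; destruct (excluded_middle_informative P); split; easy.
Qed.

Definition point (c : bcode) : baire := fun n =>
  let (k, m) := unpair n in
  match k with
  | 0 => let (t, s) := unpair m in indicator (below c t s)
  | 1 => match sub c m with leaf _ _ => 1 | node _ => 0 end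
  | 2 => match sub c m with leaf a _ => a | node _ => 0 end
  | 3 => match sub c m with leaf _ b => b | node _ => 0 end
  | _ => 0
  end.

Lemma point_below (c : bcode) (t s : nat) :
  point c (pair 0 (pair t s)) = indicator (below c t s).
Proof. unfold point; rewrite !unpair_pair; reflexivity. Qed.

(** * Validity and truth of assignments *)

Lemma c2b_eq0 (g : cantor) (s : nat) : c2b g s = 0 <-> c2b g s <> 1.
Proof. unfold c2b; destruct (g s); split; easy. Qed.

(** Truth is taken at the very point that tabulates [c]; thus the leaf test in [valid], which
    applies [f] to an entry of [f], is the leaf clause of [val]. *)
Definition true_at (c : bcode) (g : cantor) (s : nat) : Prop :=
  c2b g s = 1 <-> val (point c) (sub c s).

(** When [g] is right at the children, [valid] at [s] is the recursion clause of [val]. *)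
Lemma valid_true_at (c : bcode) (g : cantor) (s : nat) :
  (forall t, below c t s -> true_at c g t) ->
  (valid (point c) (c2b g) s <-> true_at c g s).
Proof.
  intro H; unfold valid, true_at.
  assert (R : forall k, point c (pair (S k) s) =
    match k with
    | 0 => match sub c s with leaf _ _ => 1 | node _ => 0 end
    | 1 => match sub c s with leaf a _ => a | node _ => 0 end
    | 2 => match sub c s with leaf _ b => b | node _ => 0 end
    | _ => 0
    end).
  { intro k; unfold point at 1; rewrite unpair_pair; destruct k as [|[|[|]]]; reflexivity. }
  rewrite !R; destruct (sub c s) as [a b | k] eqn:E; simpl.
  - split; intuition congruence.
  - assert (K : forall i, c2b g (child s i) = 0 <-> ~ val (point c) (k i)).
    { intro i; rewrite c2b_eq0.
      assert (T : true_at c g (child s i)).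
      { apply H, t_step; exists k, i; tauto. }
      unfold true_at in T; rewrite sub_childE, E in T; simpl in T; tauto. }
    assert (X : (exists i, c2b g (child s i) = 0) <-> exists i, ~ val (point c) (k i)).
    { split; intros [i Hi]; exists i; apply K, Hi. }
    rewrite X; intuition congruence.
Qed.

Lemma valid_below_true (c : bcode) (g : cantor) (s : nat) :
  (forall t, below c t s -> valid (point c) (c2b g) t) ->
  forall t, below c t s -> true_at c g t.
Proof.
  intros H t; induction t as [t IH] using (well_founded_ind (below_wf c)); intro Ht.
  apply valid_true_at; [|exact (H t Ht)].
  intros u Hu; apply IH; [exact Hu|].
  exact (t_trans _ _ _ _ _ Hu Ht).
Qed.

Lemma all_valid_true (c : bcode) (g : cantor) :
  (forall s, valid (point c) (c2b g) s) <-> (forall s, true_at c g s).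
Proof.
  split; intros H s.
  - apply valid_true_at; [apply valid_below_true|]; intros; apply H.
  - apply valid_true_at; intros; apply H.
Qed.

Lemma invalid_minimal (c : bcode) (g : baire) :
  ~ (forall s, valid (point c) g s) ->
  exists s, ~ valid (point c) g s /\ forall t, below c t s -> valid (point c) g t.
Proof.
  intro H; apply NNPP; intro N; apply H.
  intro s; induction s as [s IH] using (well_founded_ind (below_wf c)).
  apply NNPP; intro V; apply N; exists s; split; assumption.
Qed.

Lemma first_candidate_valid (c : bcode) (g : cantor) (m : nat) :
  (forall i, val (point c) (sub c (child 0 i)) <-> i = m) ->
  (forall s, true_at c g s) -> first_candidate (point c) (c2b g) = S m.
Proof.
  intros Hm T.
  assert (V := proj2 (all_valid_true c g) T).
  assert (C : forall i, candidate (point c) (c2b g) i <-> i = m).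
  { intro i; assert (Ti := T (child 0 i)); unfold true_at in Ti.
    rewrite <- Hm, <- Ti; unfold candidate; split.
    - intros [[_ H] | [H _]]; [exact H | destruct (H (V i))].
    (* With no invalid node, only the first disjunct of [candidate] can hold. *)
    - intro H; left; split; assumption. }
  refine (least_candidate_unique _ _ _ _ (first_candidateP _ _) _).
  left; exists m; split; [reflexivity | split; [apply C; reflexivity|]].
  intros j Hj Cj; apply C in Cj; lia.
Qed.

Lemma first_candidate_invalid (c : bcode) (g : cantor) :
  ~ (forall s, true_at c g s) ->
  exists s, first_candidate (point c) (c2b g) = S s /\ ~ true_at c g s.
Proof.
  rewrite <- all_valid_true; intro H.
  destruct (first_candidateP (point c) (c2b g)) as [[s [-> [C _]]] | [_ N]].
  - exists s; split; [reflexivity|].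
    (* The candidate must be an invalid node; row [0] of the point makes everything below it valid,
       hence true, so invalidity there means a wrong bit. *)
    destruct C as [[V _] | [V B]]; [destruct (H V)|].
    rewrite <- valid_true_at; [exact V|].
    apply valid_below_true; intros t Ht.
    apply B; rewrite point_below; apply indicator_eq1, Ht.
  - destruct (invalid_minimal _ _ H) as [s [V B]].
    destruct (N s); right; split; [exact V|].
    intros t Ht; rewrite point_below in Ht; apply B, indicator_eq1, Ht.
Qed.

(** * The true evaluation and the diagonal argument *)

Definition true_eval (c : bcode) : cantor := fun s =>
  if excluded_middle_informative (val (point c) (sub c s)) then true else false.

Lemma true_evalP (c : bcode) (s : nat) : true_at c (true_eval c) s.
Proof.
  unfold true_at, c2b, true_eval.
  destruct (excluded_middle_informative _); split; easy.
Qed.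

Lemma true_at_ext (c : bcode) (g h : cantor) (s : nat) :
  g s = h s -> true_at c g s -> true_at c h s.
Proof. unfold true_at, c2b; intros ->; exact (fun H => H). Qed.

Lemma PR_gt_index (M : (cantor -> nat) -> nat) (c : bcode) (m : nat) :
  PR M -> (forall i, val (point c) (sub c (child 0 i)) <-> i = m) ->
  m < M (fun g => first_candidate (point c) (c2b g)).
Proof.
  intros HM Hm; unfold lt.
  (* [H] is [S m] at the true evaluation and [0] at assignments with a wrong bit; local boundedness
     then forces the realiser to reach [S m]. *)
  pose (H (g : cantor) := indicator (forall s, true_at c g s) * S m).
  replace (S m) with (H (true_eval c)).
  2: { unfold H; rewrite (proj2 (indicator_eq1 _) (true_evalP c)); lia. }
  apply (HM H); intros h g E; unfold H, indicator.
  destruct (excluded_middle_informative _) as [T | _]; [|lia].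
  destruct (classic (forall s, true_at c h s)) as [Th | Th].
  - rewrite (first_candidate_valid c h m Hm Th); lia.
  - destruct (first_candidate_invalid c h Th) as [s [Es Ns]].
    (* The radius [S s] covers position [s], so [h] would share the correct bit of [g] there. *)
    destruct Ns; apply (true_at_ext c g); [|apply T].
    apply E; rewrite Es; lia.
Qed.

Theorem theorem3p2 :
  exists F : baire -> baire -> nat,
    arithmetical2 F /\
    forall M : (cantor -> nat) -> nat,
      PR M -> ~ borel_measurable (fun f : baire => M (fun g : cantor => F f (c2b g))).
Proof.
  exists first_candidate; split; [exact first_candidate_arithmetical|].
  intros M HM HB.
  set (B := fun f : baire => M (fun g : cantor => first_candidate f (c2b g))) in HB.
  assert (HC : forall n, coded (fun x => B x = n)).
  { intro n; apply borel_coded, (HB (fun k => k = n)). }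
  pose (k n := proj1_sig (constructive_indefinite_description _ (HC n))).
  assert (Hk : forall n x, val x (k n) <-> B x = n).
  { intro n; exact (proj2_sig (constructive_indefinite_description _ (HC n))). }
  (* Child [i] of the root presents the set where [B] equals [i], so at this point exactly the child
     with index [B (point (node k))] is true. *)
  apply (Nat.lt_irrefl (B (point (node k)))).
  apply (PR_gt_index M (node k)); [exact HM|].
  intro i; rewrite sub_childE; simpl; rewrite Hk; split; auto.
Qed.
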